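(* Let $(X,T)$ be a topological dynamical system and let $\mathcal{F}=\{f_n\}_{n\ge1}$ and $\Phi=\{\varphi_n\}_{n\ge1}$ be two asymptotically additive potentials on $X$. Then the map $\alpha\mapsto\Lambda_{\mathcal{F}\mid\Phi}(\alpha)$ is continuous on the interval $[\eta(\Phi),\beta(\Phi)]$.
   Context: $X$ is a compact metric space and $T:X\to X$ is continuous. $\mathcal{M}_T$ denotes the set of $T$-invariant Borel probability measures on $X$ (with the weak$^*$ topology) and $\mathcal{E}_T$ the set of ergodic ones. For $f\in C(X)$, $S_nf=\sum_{i=0}^{n-1}f\circ T^i$. A sequence $\mathcal{F}=\{f_n\}_{n\ge1}\subset C(X)$ is an asymptotically additive potential (AAP) if for every $\xi>0$ there is $f_\xi\in C(X)$ with $\limsup_{n\to\infty}\frac1n\|f_n-S_nf_\xi\|_\infty<\xi$. For $\mu\in\mathcal{M}_T$ the limit $\mathcal{F}_*(\mu)=\lim_{n\to\infty}\frac1n\int f_n\,d\mu$ exists and is finite, and $\mu\mapsto\mathcal{F}_*(\mu)$ is continuous on $\mathcal{M}_T$. Define $\beta(\Phi)=\max\{\Phi_*(\mu):\mu\in\mathcal{M}_T\}$, $\eta(\Phi)=\min\{\Phi_*(\mu):\mu\in\mathcal{M}_T\}$, $\mathcal{M}_T(\Phi,\alpha)=\{\mu\in\mathcal{M}_T:\Phi_*(\mu)=\alpha\}$, and the conditional maximum ergodic average $\Lambda_{\mathcal{F}\mid\Phi}(\alpha)=\sup\{\mathcal{F}_*(\mu):\mu\in\mathcal{M}_T(\Phi,\alpha)\}$.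 *)

(* Defs.v *)
From HB Require Import structures.
From mathcomp Require Import all_boot all_order all_algebra.
From mathcomp Require Import all_classical all_reals all_analysis.
Set Implicit Arguments. Unset Strict Implicit. Unset Printing Implicit Defensive.
Import Order.TTheory GRing.Theory Num.Theory.
Import numFieldNormedType.Exports.
Local Open Scope classical_set_scope.
Local Open Scope ring_scope.

Section Defs.
Context {R : realType} {X : pseudoPMetricType R}.

Local Notation borelX := (g_sigma_algebraType (@open X)).

Definition probX := probability borelX R.

Definition invariant (T : X -> X) (mu : probX) : Prop :=
  forall A : set borelX, measurable A -> mu (T @^-1` A) = mu A.

Definition MT (T : X -> X) : set probX := [set mu | invariant T mu].

Definition integ (mu : probX) (f : X -> R) : R :=
  fine (\int[mu]_(x in [set: borelX]) (f x)%:E)%E.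

Definition birkhoff (T : X -> X) (n : nat) (f : X -> R) : X -> R :=
  fun x => \sum_(i < n) f (iter i T x).

Definition supnorm (h : X -> R) : R := sup [set `|h x| | x in [set: X]].

(* Asymptotically additive potential; the sequence is indexed by nat, only
   indices n >= 1 are relevant (the value at 0 never matters). *)
Definition AAP (T : X -> X) (F : nat -> X -> R) : Prop :=
  (forall n, continuous (F n)) /\
  forall xi : R, 0 < xi -> exists g : X -> R, continuous g /\
    (limn_esup (fun n => ((n%:R)^-1 * supnorm (F n \- birkhoff T n g))%:E) < xi%:E)%E.

Definition Fstar (F : nat -> X -> R) (mu : probX) : R :=
  limn (fun n => (n%:R)^-1 * integ mu (F n)).

(* beta(Phi) = max, eta(Phi) = min of Phi_* over M_T (attained, so sup/inf) *)
Definition betaP (T : X -> X) (Phi : nat -> X -> R) : R :=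
  sup [set Fstar Phi mu | mu in MT T].
Definition etaP (T : X -> X) (Phi : nat -> X -> R) : R :=
  inf [set Fstar Phi mu | mu in MT T].

Definition MTlevel (T : X -> X) (Phi : nat -> X -> R) (alpha : R) : set probX :=
  [set mu | MT T mu /\ Fstar Phi mu = alpha].

Definition Lambda (T : X -> X) (F Phi : nat -> X -> R) (alpha : R) : R :=
  sup [set Fstar F mu | mu in MTlevel T Phi alpha].

End Defs.

(* Main.v *)
(** M_T is convex and weak-star sequentially compact, and the averages of F and
    Phi are affine and weak-star continuous on it, being uniform limits on M_T of
    integrals of continuous functions.  Hence Lambda is the upper boundary of a
    compact convex planar set, the image of M_T under both averages: chords to
    the extreme points of that set give lower semicontinuity, compactness gives
    upper semicontinuity.

    Compactness of M_T: along an ultrafilter the integrals of each continuous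
    function converge, and the limit is a positive normalised T-invariant
    functional L.  It is represented by an invariant measure (Riesz), namely the
    Caratheodory restriction of the outer measure
    A |-> inf {sup {L f | 0 <= f <= 1_G} | G open, A contained in G}.
    Convexity of M_T is another instance of the same representation theorem. *)
Require Import Defs.
From HB Require Import structures.
From mathcomp Require Import all_boot all_order all_algebra.
From mathcomp Require Import all_classical all_reals all_analysis.
From mathcomp Require Import measurable_realfun lra ring.
Set Implicit Arguments. Unset Strict Implicit. Unset Printing Implicit Defensive.
Import Order.TTheory GRing.Theory Num.Theory.
Import numFieldNormedType.Exports.
Local Open Scope classical_set_scope.
Local Open Scope ring_scope.

(** Normalising divides by the total mass 1 and so changes no value; the Dirac fallback of
    [mnormalize] concerns only total mass 0 or infinity. *)
Lemma measure_probability d (T : measurableType d) (R : realType)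
    (m : {measure set T -> \bar R}) : m [set: T] = 1%E ->
  exists P : probability T R, forall A, P A = m A.
Proof.
move=> mT; exists (mnormalize m (dirac point : probability T R)) => A.
by rewrite /= /mnormalize/= mT onee_eq0/= invr1 mule1.
Qed.

(** * Truncated distance to the complement of a set *)

Section distance_to_complement.
Context {R : realType} {X : pseudoPMetricType R}.
Implicit Types (G : set X) (x y : X).

(* [r = 0] is added by hand since [ball x 0] is unspecified. *)
Definition inner_radii G x : set R :=
  [set r | r = 0 \/ [/\ 0 < r, r <= 1 & ball x r `<=` G]].

(** The distance from [x] to the complement of [G], capped at 1 so that it stays finite when [G] is
    the whole space. *)
Definition cdist G x : R := sup (inner_radii G x).

Lemma has_sup_inner_radii G x : has_sup (inner_radii G x).
Proof.
split; first by exists 0; left.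
by exists 1 => r [->//|[]].
Qed.

Lemma cdist_ub G x r : inner_radii G x r -> r <= cdist G x.
Proof. by move=> Gr; apply: ub_le_sup => //; case: (has_sup_inner_radii G x). Qed.

Lemma cdist_ge0 G x : 0 <= cdist G x.
Proof. by apply: cdist_ub; left. Qed.

Lemma cdist_gt0 G x : open G -> G x -> 0 < cdist G x.
Proof.
move=> oG Gx; have /nbhs_ballP[e /= e0 eG] : nbhs x G by exact: open_nbhs_nbhs.
have m0 : 0 < Num.min e 1 by rewrite lt_min e0 ltr01.
apply: (lt_le_trans m0); apply: cdist_ub; right; split => //.
  by rewrite ge_min lexx orbT.
by apply: subset_trans eG; apply: le_ball; rewrite ge_min lexx.
Qed.

Lemma cdist_out G x : ~ G x -> cdist G x = 0.
Proof.
move=> Gx; apply/eqP; rewrite eq_le cdist_ge0 andbT.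
apply: ge_sup; first by exists 0; left.
move=> r [->//|[r0 _ xG]]; exfalso; apply: Gx; apply: xG; exact: ballxx.
Qed.

(** If the [r]-ball at [x] lies in [G] and [e < r], the triangle inequality puts the ball of radius
    [r - e] at [y] in [G]. Used in both directions, this gives continuity. *)
Lemma cdist_lip G x y e : ball x e y -> 0 < e -> cdist G x <= cdist G y + e.
Proof.
move=> xy e0; apply: ge_sup; first by exists 0; left.
move=> r [->|[r0 r1 xG]]; first by rewrite addr_ge0 ?cdist_ge0// ltW.
rewrite -lerBlDr; have [re|er] := lerP r e.
  by rewrite (le_trans _ (cdist_ge0 _ _))// subr_le0.
apply: cdist_ub; right; split; first by rewrite subr_gt0.
  by rewrite (le_trans _ r1)// gerBl ltW.
by move=> z yz; apply: xG; rewrite -(subrK e r) addrC; exact: ball_triangle yz.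
Qed.

Lemma continuous_cdist G : continuous (cdist G).
Proof.
move=> x; apply/cvgrPdist_le => e e0; near=> y.
have xy : ball x e y by near: y; exact: nbhsx_ballx.
rewrite ler_distl lerBlDr; apply/andP; split; apply: cdist_lip => //.
exact: ball_sym.
Unshelve. all: by end_near. Qed.

End distance_to_complement.

(** * Positive normalised functionals on continuous functions *)

Section positive_functional.
Context {R : realType} {X : pseudoPMetricType R}.
Hypothesis cX : compact [set: X].
Variable L : (X -> R) -> R.
Hypothesis LD : forall f g : X -> R, continuous f -> continuous g ->
  L (fun x => f x + g x) = L f + L g.
Hypothesis LZ : forall (c : R) (f : X -> R), continuous f ->
  L (fun x => c * f x) = c * L f.
Hypothesis L_ge0 : forall f : X -> R, continuous f -> (forall x, 0 <= f x) -> 0 <= L f.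
Hypothesis L1 : L (fun=> 1) = 1.
Implicit Types (f g : X -> R) (G A : set X).

Lemma functional_le f g : continuous f -> continuous g ->
  (forall x, f x <= g x) -> L f <= L g.
Proof.
move=> cf cg fg.
(* The difference is written with [- 1 *] so that additivity and homogeneity of [L] apply to it. *)
have cgf : continuous (fun x => g x + - 1 * f x).
  by move=> x; apply: cvgD; [exact: cg|apply: cvgM; [exact: cvg_cst|exact: cf]].
have : 0 <= L (fun x => g x + - 1 * f x).
  by apply: L_ge0 => // x; rewrite mulN1r subr_ge0.
have cNf : continuous (fun x => - 1 * f x).
  by move=> x; apply: cvgM; [exact: cvg_cst|exact: cf].
by rewrite LD// LZ// mulN1r subr_ge0.
Qed.

Lemma functional_cst c : L (fun=> c) = c.
Proof.
rewrite -[RHS]mulr1 -[in RHS]L1 -LZ => [|x]; last exact: cvg_cst.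
by congr L; apply/funext => x; rewrite mulr1.
Qed.

Lemma continuous_sumr (I : Type) (r : seq I) (h : I -> X -> R) :
  (forall i, continuous (h i)) -> continuous (fun x => \sum_(i <- r) h i x).
Proof.
move=> ch; elim: r => [|i r IH] x.
  by under eq_fun do rewrite big_nil; exact: cvg_cst.
under eq_fun do rewrite big_cons.
by apply: cvgD; [exact: ch|exact: IH].
Qed.

Lemma functional_sum (I : Type) (r : seq I) (h : I -> X -> R) :
  (forall i, continuous (h i)) ->
  L (fun x => \sum_(i <- r) h i x) = \sum_(i <- r) L (h i).
Proof.
move=> ch; elim: r => [|i r IH].
  rewrite big_nil -[RHS]functional_cst; congr L; apply/funext => x.
  by rewrite big_nil.
rewrite big_cons -IH -LD//; last exact: continuous_sumr.
by congr L; apply/funext => x; rewrite big_cons.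
Qed.

(** * Sizes of open sets *)

Definition below G f : Prop :=
  [/\ continuous f, forall x, 0 <= f x & forall x, f x <= \1_G x].

Lemma below0 G : below G (fun=> 0).
Proof. by split => [x|x|x]; [exact: cvg_cst| |rewrite indicE ler0n]. Qed.

Definition open_size G : R := sup [set L f | f in below G].

Lemma below_le1 G f x : below G f -> f x <= 1.
Proof. by move=> [_ _ /(_ x) /le_trans]; apply; rewrite indicE lern1 leq_b1. Qed.

Lemma below_functional_le1 G f : below G f -> L f <= 1.
Proof.
move=> Gf; rewrite -L1; apply: functional_le.
- by case: Gf.
- by move=> x; exact: cvg_cst.
- by move=> x; exact: below_le1 Gf.
Qed.

Lemma open_size_ub G f : below G f -> L f <= open_size G.
Proof.
move=> Gf; apply: ub_le_sup; last by exists f.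
by exists 1 => _ [g Gg <-]; exact: below_functional_le1 Gg.
Qed.

Lemma open_size_le G c : (forall f, below G f -> L f <= c) -> open_size G <= c.
Proof.
move=> Gc; apply: ge_sup; first by exists (L (fun=> 0)), (fun=> 0) => //; exact: below0.
by move=> _ [f Gf <-]; exact: Gc.
Qed.

Lemma open_size_ge0 G : 0 <= open_size G.
Proof. by rewrite -[leLHS]functional_cst; exact: open_size_ub (below0 G). Qed.

Lemma open_size0 : open_size set0 = 0.
Proof.
apply/eqP; rewrite eq_le open_size_ge0 andbT; apply: open_size_le => f [cf f0 f1].
rewrite -[leRHS]functional_cst; apply: functional_le => // x; first exact: cvg_cst.
by rewrite (le_trans (f1 x))// indic0.
Qed.

Lemma open_sizeT : open_size setT = 1.
Proof.
apply/eqP; rewrite eq_le; apply/andP; split.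
  by apply: open_size_le => f; exact: below_functional_le1.
rewrite -L1; apply: open_size_ub; split => x; [exact: cvg_cst|exact: ler01|].
by rewrite indicT.
Qed.

Lemma below_sub A G f : A `<=` G -> below A f -> below G f.
Proof.
move=> AG [cf f0 f1]; split => // x; rewrite (le_trans (f1 x))// !indicE ler_nat.
by case: (boolP (x \in A)) => // /set_mem/AG/mem_set ->.
Qed.

Lemma open_size_mono A G : A `<=` G -> open_size A <= open_size G.
Proof.
by move=> AG; apply: open_size_le => f Af; apply/open_size_ub/(below_sub AG).
Qed.

(** For open [G] these functions increase pointwise to the indicator of [G] as [k] grows. *)
Definition bump G (k : R) : X -> R := fun x => Num.min 1 (k * cdist G x).

Lemma below_bump G k : 0 <= k -> below G (bump G k).
Proof.
move=> k0; split => x.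
- apply: (@continuous_min R X (fun=> 1) (fun x => k * cdist G x)).
    exact: cvg_cst.
  by apply: cvgM; [exact: cvg_cst|exact: continuous_cdist].
- by rewrite /bump le_min ler01/= mulr_ge0// cdist_ge0.
- rewrite indicE; case: (boolP (x \in G)) => [_|/negP xG].
    by rewrite /bump ge_min lexx.
  by rewrite /bump cdist_out ?mulr0 ?ge_min ?lexx ?orbT// => /mem_set.
Qed.

Lemma sum_min_ge1 (I : Type) (r : seq I) (a : I -> R) :
  (forall i, 0 <= a i) -> 1 <= \sum_(i <- r) a i ->
  1 <= \sum_(i <- r) Num.min 1 (a i).
Proof.
(* Truncation at 1 is subadditive on nonnegative numbers. *)
move=> a0; suff : Num.min 1 (\sum_(i <- r) a i) <= \sum_(i <- r) Num.min 1 (a i).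
  by move=> /[swap] a1; rewrite min_l.
elim: r => [|i r IH]; first by rewrite !big_nil ge_min lexx orbT.
rewrite !big_cons; set s := \sum_(j <- r) a j in IH *.
set t := \sum_(j <- r) _ in IH *.
have s0 : 0 <= s by exact: sumr_ge0.
have := a0 i; move: IH; rewrite /Num.min.
by case: ifPn => ?; case: ifPn => ?; case: ifPn => ?; lra.
Qed.

(* By compactness finitely many of the bumps of the [G i] dominate [f - e]. *)
Lemma below_bigcup (S : X -> X) (G : nat -> set X) f e :
  continuous S -> (forall h, continuous h -> L (h \o S) = L h) ->
  (forall i, open (G i)) -> 0 < e -> below (S @^-1` (\bigcup_i G i)) f ->
  exists k, L f <= e + \sum_(i < k) open_size (G i).
Proof.
move=> cS LS oG e0 Gf; have [cf f0 f1] := Gf.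
have bb i k : below (G i) (bump (G i) k%:R) by exact/below_bump/ler0n.
have [k kP] : exists k, forall x, f x <= e + \sum_(i < k) bump (G i) k%:R (S x).
  (* Compactness in near-covering form: a bound valid near each point for all large [k] holds
     everywhere for a single [k]. *)
  have /compact_near_coveringP cov := cX.
  have [|k _ kP] := cov nat \oo
    (fun k x => f x <= e + \sum_(i < k) bump (G i) k%:R (S x)) _; last first.
    by exists k => x; apply: (kP k) => //=.
  (* Near a point with [f x < e] the constant [e] suffices; otherwise [f x > 0], so [S x] lies in
     some [G i]. *)
  move=> x _; have [fxe|efx] := ltP (f x) e.
    have fe : \forall y \near x, f y < e by exact: (cvgr_lt _ (cf x)).
    exists ([set y | f y < e], setT); first by split => //; exact: filterT.
    move=> [y k] [/= fye _]; rewrite (le_trans (ltW fye))// lerDl.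
    by apply: sumr_ge0 => i _; case: (bb i k).
  have [i _ Gix] : (\bigcup_i G i) (S x).
    have := f1 x; rewrite indicE; case: (boolP (x \in _)) => [/set_mem//|_].
    by rewrite leNgt (lt_le_trans e0 efx).
  have dx := cdist_gt0 (oG i) Gix.
  pose d := cdist (G i) (S x) / 2.
  have d0 : 0 < d by rewrite divr_gt0.
  have dnear : \forall y \near x, d < cdist (G i) (S y).
    have cd := continuous_comp (cS x) (@continuous_cdist R X (G i) (S x)).
    by apply: (cvgr_gt _ cd); rewrite /= /d; lra.
  (* [i < k] puts the [i]-th bump into the sum, and [d^-1 < k] makes [k * cdist] exceed 1 near
     [x]. *)
  exists ([set y | d < cdist (G i) (S y)],
    [set k | (i < k)%N /\ d^-1 < k%:R]) => /=.
    split => //; apply: filterI; first exact: nbhs_infty_gt.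
    exact: nbhs_infty_gtr.
  move=> [y k] [/= dly [ik dk]]; rewrite (le_trans (below_le1 y Gf))//.
  rewrite (@le_trans _ _ (\sum_(j < k) bump (G j) k%:R (S y)))//; last first.
    by rewrite lerDr ltW.
  apply: sum_min_ge1 => [j|]; first by rewrite mulr_ge0// cdist_ge0.
  rewrite (bigD1 (Ordinal ik))//= ler_wpDr//.
    by apply: sumr_ge0 => j _; rewrite mulr_ge0// cdist_ge0.
  rewrite -[leLHS](mulVf (lt0r_neq0 d0)).
  by apply: ler_pM; rewrite ?invr_ge0 ltW.
exists k.
have cb i : continuous (bump (G i) k%:R) by case: (bb i k).
have cbS i : continuous (bump (G i) k%:R \o S).
  by move=> x; apply: continuous_comp; [exact: cS|exact: cb].
rewrite (@le_trans _ _ (e + \sum_(i < k) L (bump (G i) k%:R)))//; last first.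
  by rewrite lerD2l; apply: ler_sum => i _; exact/open_size_ub/bb.
have cs := @continuous_sumr _ (index_enum 'I_k) _ (fun i => cbS i).
under eq_bigr do rewrite -LS//.
rewrite -functional_sum// -[in leRHS](functional_cst e) -LD//; last first.
  by move=> x; exact: cvg_cst.
by apply: functional_le => // x; apply: cvgD; [exact: cvg_cst|exact: cs].
Qed.

(** Composition with [S] turns functions below [G] into functions below its preimage, with the same
    [L]. Conversely, the covering estimate is applied to the sequence [G], empty, empty, and so
    on. *)
Lemma open_size_preimage (S : X -> X) G : continuous S -> open G ->
  (forall h, continuous h -> L (h \o S) = L h) ->
  open_size (S @^-1` G) = open_size G.
Proof.
move=> cS oG LS; apply/eqP; rewrite eq_le; apply/andP; split; last first.
  apply: open_size_le => f [cf f0 f1]; rewrite -LS//; apply: open_size_ub.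
  split => x; [|exact: f0|exact: f1].
  by apply: continuous_comp; [exact: cS|exact: cf].
pose Gs i := if i is 0%N then G else set0.
have oGs i : open (Gs i) by case: i => // n; exact: open0.
have GsE : \bigcup_i Gs i = G.
  apply/seteqP; split => [x [[|i] _]//|x Gx]; by exists 0%N.
apply: open_size_le => f; rewrite -GsE => Gf; apply/ler_addgt0Pr => e e0.
have [k /le_trans] := below_bigcup cS LS oGs e0 Gf; apply.
rewrite addrC lerD2r GsE; case: k => [|k]; first by rewrite big_ord0 open_size_ge0.
by rewrite big_ord_recl big1 ?addr0// => i _; exact: open_size0.
Qed.

(** The covering estimate with [S = id] bounds [L f] by [e] plus a partial sum of the series, for
    every [f] below the union. *)
Lemma open_size_bigcup (G : nat -> set X) : (forall i, open (G i)) ->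
  ((open_size (\bigcup_i G i))%:E <= \sum_(i <oo) (open_size (G i))%:E)%E.
Proof.
move=> oG; set S := (\sum_(i <oo) _)%E.
have ge0 i : true -> true -> (0 <= (open_size (G i))%:E)%E.
  by rewrite lee_fin open_size_ge0.
have S0 : (0 <= S)%E by apply: nneseries_ge0 => n _ _; exact: ge0.
have part k : ((\sum_(i < k) open_size (G i))%:E <= S)%E.
  rewrite -sumEFin -(big_mkord xpredT (fun i => (open_size (G i))%:E)).
  by apply: nneseries_lim_ge => n _ _; exact: ge0.
(* A divergent series leaves nothing to prove; nonnegativity excludes minus infinity. *)
case: S S0 part => [r| |] //= _ part; last by rewrite leey.
rewrite lee_fin; apply: open_size_le => f Gf; apply/ler_addgt0Pr => e e0.
have [k /le_trans] :=
  @below_bigcup id _ _ _ (fun x => cvg_id) (fun h _ => erefl) oG e0 Gf; apply.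
by rewrite addrC lerD2r -lee_fin; exact: part.
Qed.

(** * The outer measure and its restriction to Borel sets *)

Definition outer_size A : R :=
  inf [set open_size G | G in [set G | open G /\ A `<=` G]].

Lemma has_inf_open_size A :
  has_inf [set open_size G | G in [set G | open G /\ A `<=` G]].
Proof.
split; first by exists (open_size setT), setT => //; split => //; exact: openT.
by exists 0 => _ [G _ <-]; exact: open_size_ge0.
Qed.

Lemma outer_size_lb A G : open G -> A `<=` G -> outer_size A <= open_size G.
Proof.
move=> oG AG; apply: ge_inf; first by case: (has_inf_open_size A).
by exists G.
Qed.

Lemma outer_size_ge A c :
  (forall G, open G -> A `<=` G -> c <= open_size G) -> c <= outer_size A.
Proof.
move=> cG; apply: lb_le_inf; first by case: (has_inf_open_size A).
by move=> _ [G [oG AG] <-]; exact: cG.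
Qed.

Lemma outer_size_open G : open G -> outer_size G = open_size G.
Proof.
move=> oG; apply/eqP; rewrite eq_le outer_size_lb//=.
by apply: outer_size_ge => U oU GU; exact: open_size_mono.
Qed.

Lemma outer_size_adherent A e : 0 < e ->
  exists G, [/\ open G, A `<=` G & open_size G <= outer_size A + e].
Proof.
move=> e0; have [_ [G [oG AG] <-] /ltW Ge] := inf_adherent e0 (has_inf_open_size A).
by exists G.
Qed.

Lemma outer_size_mono A G : A `<=` G -> outer_size A <= outer_size G.
Proof.
move=> AG; apply: outer_size_ge => U oU GU; apply: outer_size_lb => //.
exact: subset_trans GU.
Qed.

Lemma outer_size_ge0 A : 0 <= outer_size A.
Proof. by apply: outer_size_ge => G _ _; exact: open_size_ge0. Qed.

Let outerE A : \bar R := (outer_size A)%:E.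

Let outerE0 : outerE set0 = 0%E.
Proof. by rewrite /outerE outer_size_open ?open_size0//; exact: open0. Qed.

Let outerE_ge0 A : (0 <= outerE A)%E.
Proof. by rewrite lee_fin outer_size_ge0. Qed.

Let le_outerE : {homo outerE : A G / A `<=` G >-> (A <= G)%E}.
Proof. by move=> A G AG; rewrite lee_fin outer_size_mono. Qed.

Let outerE_sigma_subadditive : sigma_subadditive outerE.
Proof.
move=> A; apply/lee_addgt0Pr => e e0.
(* Each [A n] gets an open superset of excess at most [e / 2 ^ n.+1]; these excesses add up to
   [e]. *)
apply: le_trans (epsilon_trick xpredT (fun n => outerE_ge0 (A n)) (ltW e0)).
have en n : 0 < e / (2 ^ n.+1)%:R by rewrite divr_gt0// ltr0n expn_gt0.
have [G GA] := choice (fun n => outer_size_adherent (A n) (en n)).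
have oG n : open (G n) by case: (GA n).
apply: (@le_trans _ _ (open_size (\bigcup_n G n))%:E).
  rewrite lee_fin; apply: outer_size_lb; first exact: bigcup_open.
  by apply: subset_bigcup => n _; case: (GA n).
apply: le_trans (open_size_bigcup oG) _; apply: lee_nneseries => n _ //.
  by rewrite lee_fin open_size_ge0.
by rewrite -EFinD lee_fin; case: (GA n).
Qed.

Let outer : {outer_measure set X -> \bar R} :=
  HB.pack outerE (isOuterMeasure.Build R X outerE outerE0 outerE_ge0 le_outerE
    outerE_sigma_subadditive).

Lemma functional_le_shift f g e : continuous f -> continuous g ->
  (forall x, f x <= g x + e) -> L f <= L g + e.
Proof.
move=> cf cg fg; rewrite -[in leRHS](functional_cst e) -LD//; last first.
  by move=> x; exact: cvg_cst.
apply: functional_le => // x; apply: cvgD; [exact: cg|exact: cvg_cst].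
Qed.

(* Truncating [f <= 1_(A & G)] to [max (f - e) 0] makes its support a closed
   subset [K] of [G], leaving room for the open set [A \ K]. *)
Lemma open_size_split A G : open A -> open G ->
  open_size (A `&` G) + outer_size (A `&` ~` G) <= open_size A.
Proof.
move=> oA oG; rewrite -lerBrDr; apply: open_size_le => f Af.
have [cf f0 f1] := Af; rewrite lerBrDr; apply/ler_addgt0Pr => e e0.
pose fe x := Num.max (f x - e) 0.
have cfe : continuous fe.
  move=> x; apply: (@continuous_max R X (fun x => f x - e) (fun=> 0)).
    by apply: cvgB; [exact: cf|exact: cvg_cst].
  exact: cvg_cst.
pose V := A `&` [set x | f x < e].
have oV : open V.
  apply: openI => //; apply: (@open_comp _ _ f [set y | y < e]); last exact: open_lt.
  by move=> x _; exact: cf.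
(* Off [G] the function [f] vanishes, being below [A] intersected with [G]. *)
have AGV : A `&` ~` G `<=` V.
  move=> x [Ax Gx]; split => //=; rewrite (le_lt_trans (f1 x))// indicE memNset// => -[_].
  exact: Gx.
have Lfe : L f <= L fe + e.
  apply: functional_le_shift => // x.
  by rewrite -lerBlDr /fe le_max lexx.
apply: (@le_trans _ _ (L fe + e + open_size V)).
  by apply: lerD => //; exact: outer_size_lb.
rewrite [leRHS]addrC addrAC [leLHS]addrC lerD2l -lerBrDl.
(* For [g] below [V], [fe + g] is below [A]: on [V] [fe] vanishes and [g <= 1], while off [V] [g]
   vanishes and [fe <= 1]. *)
apply: open_size_le => g [cg g0 g1]; rewrite lerBrDl -LD//.
apply: open_size_ub; split => x.
- by apply: cvgD; [exact: cfe|exact: cg].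
- by rewrite addr_ge0// /fe le_max lexx orbT.
- have := f1 x; have := g1 x; have := f0 x; have := g0 x; rewrite !indicE /fe.
  case: (boolP (x \in A)) => [/set_mem Ax|Ax]; last first.
    rewrite !memNset; [|by case => /mem_set; rewrite (negbTE Ax)..].
    by rewrite /= maxEle; case: (leP (f x - e) 0) => ? ? ? ? ?; lra.
  case: (boolP (x \in V)) => [/set_mem[_ /= fxe]|_].
    by rewrite /= max_r => [? ? ? ?|]; [lra|rewrite subr_le0 ltW].
  move=> g00 _ g_le0 fAG; have : f x <= 1 by exact: below_le1 Af.
  by move: g_le0 => /=; rewrite maxEle; case: (leP (f x - e) 0) => ? ? ?; lra.
Qed.

(** An arbitrary test set is replaced by an open superset [U], which [open_size_split] cuts along
    [G]; the infimum over [U] gives the nontrivial Caratheodory inequality. *)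
Let outer_open_caratheodory G : open G -> outer.-caratheodory G.
Proof.
move=> oG; apply: le_caratheodory_measurable => A.
rewrite /outer/= /outerE -EFinD lee_fin; apply: outer_size_ge => U oU AU.
apply: le_trans (open_size_split oU oG); apply: lerD.
  by apply: outer_size_lb; [exact: openI|exact: setSI].
by apply: outer_size_mono; exact: setSI.
Qed.

Local Notation borelX := (g_sigma_algebraType (@open X)).

Let borel_caratheodory (A : set borelX) : measurable A -> outer.-caratheodory A.
Proof.
suff : <<s (@open X) >> `<=` outer.-cara.-measurable by exact.
apply: smallest_sub => [|G oG]; last exact: outer_open_caratheodory.
split => //; [by move=> Y mY; rewrite setTD; exact: measurableC |
              by move=> u_ mu_; exact: bigcupT_measurable].
Qed.

Lemma functional_measure : exists mu : probability borelX R,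
  forall G, open G -> mu G = (open_size G)%:E.
Proof.
pose m : set borelX -> \bar R := outerE.
have m0 : m set0 = 0%E by [].
have madd : semi_sigma_additive m.
  move=> F mF tF mUF.
  by apply: (@caratheodory_measure_sigma_additive R X outer) => // [i|];
    exact: borel_caratheodory.
have mT : m setT = 1%E by rewrite /m /outerE outer_size_open ?open_sizeT//; exact: openT.
pose mm : {measure set borelX -> \bar R} :=
  HB.pack m (isMeasure.Build _ _ _ m m0 outerE_ge0 madd).
have [P PE] := @measure_probability _ _ _ mm mT.
by exists P => G oG; rewrite PE/= /m /outerE outer_size_open.
Qed.

End positive_functional.

(** * Integrals against Borel probability measures *)

Section integ_theory.
Context {R : realType} {X : pseudoPMetricType R}.
Local Notation borelX := (g_sigma_algebraType (@open X)).
Implicit Types (mu : @probX R X) (f g : X -> R) (G : set X).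

Lemma open_borel G : open G -> measurable (G : set borelX).
Proof. by move=> oG; exact: sub_sigma_algebra. Qed.

Lemma continuous_borel f : continuous f ->
  measurable_fun [set: borelX] (f : borelX -> R).
Proof.
move=> cf; apply: (measurability _ (RGenOpens.measurableE R)).
move=> _ [_ [a [b ->] <-]]; rewrite setTI; apply: open_borel.
by apply: (@open_comp _ _ f) => [x _|]; [exact: cf|exact: interval_open].
Qed.

Lemma continuous_borel_self (T : X -> X) : continuous T ->
  measurable_fun [set: borelX] (T : borelX -> borelX).
Proof.
move=> cT; apply: (@measurability _ _ borelX borelX _ _ (@open X)) => //.
move=> _ [G oG <-]; rewrite setTI; apply: open_borel.
by apply: (@open_comp _ _ T) => // x _; exact: cT.
Qed.

Definition integrb mu f : Prop := mu.-integrable [set: borelX] (EFin \o f).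

Lemma bounded_integrb mu f M :
  measurable_fun [set: borelX] (f : borelX -> R) -> (forall x, `|f x| <= M) ->
  integrb mu f.
Proof.
move=> mf fM; apply: measurable_bounded_integrable => //.
  by rewrite [X in (X < _)%E]probability_setT ltry.
by exists M; split; [exact: num_real|move=> y My x _; exact: le_trans (fM x) (ltW My)].
Qed.

Lemma integE mu f : integ mu f = (\int[mu]_(x in [set: borelX]) f x)%R.
Proof. by []. Qed.

Lemma integD mu f g : integrb mu f -> integrb mu g ->
  integ mu (fun x => f x + g x) = integ mu f + integ mu g.
Proof. by move=> *; rewrite !integE RintegralD. Qed.

Lemma integZ mu c f : integrb mu f ->
  integ mu (fun x => c * f x) = c * integ mu f.
Proof. by move=> *; rewrite !integE RintegralZl. Qed.

Lemma integ_ge0 mu f : (forall x, 0 <= f x) -> 0 <= integ mu f.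
Proof. by move=> f0; rewrite integE; exact: Rintegral_ge0. Qed.

Lemma integ_cst mu c : integ mu (fun=> c) = c.
Proof. by rewrite integE Rintegral_cst// [X in fine X]probability_setT mulr1. Qed.

Lemma integ_le mu f g : integrb mu f -> integrb mu g ->
  (forall x, f x <= g x) -> integ mu f <= integ mu g.
Proof. by move=> ? ? fg; rewrite !integE; exact: le_Rintegral. Qed.

Lemma integrb_sum mu n (h : nat -> X -> R) : (forall i, integrb mu (h i)) ->
  integrb mu (fun x => \sum_(i < n) h i x).
Proof.
move=> ih; rewrite /integrb.
have -> : EFin \o (fun x => \sum_(i < n) h i x) =
  (fun x => \sum_(i < n) (EFin \o h i) x)%E.
  by apply/funext => x /=; rewrite sumEFin.
by apply: integrable_sum => // i _; exact: ih.
Qed.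

Lemma integ_sum mu n (h : nat -> X -> R) : (forall i, integrb mu (h i)) ->
  integ mu (fun x => \sum_(i < n) h i x) = \sum_(i < n) integ mu (h i).
Proof.
move=> ih; elim: n => [|n IH].
  rewrite big_ord0 -[RHS](integ_cst mu); congr integ; apply/funext => x.
  by rewrite big_ord0.
rewrite big_ord_recr/= -IH -integD//; last exact: integrb_sum.
by congr integ; apply/funext => x; rewrite big_ord_recr.
Qed.

Lemma integrb_indic mu G : open G -> integrb mu (\1_G : X -> R).
Proof.
move=> oG; apply: (@bounded_integrb mu _ 1).
  by apply: measurable_indic; exact: open_borel.
by move=> x; rewrite indicE; case: (_ \in _); rewrite ?normr1// normr0.
Qed.

Lemma integ_indic mu G : open G -> (integ mu \1_G)%:E = mu G.
Proof.
move=> oG; have mG := open_borel oG.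
by rewrite /integ integral_indic// setIT fineK// fin_num_measure.
Qed.

Hypothesis cX : compact [set: X].

Lemma continuous_bounded f : continuous f -> exists M, forall x, `|f x| <= M.
Proof.
move=> cf; have : compact (f @` [set: X]).
  by apply: continuous_compact => //; exact: continuous_subspaceT.
move/compact_bounded => [M [_ Mf]]; exists (M + 1) => x.
by apply: Mf; [rewrite ltrDl|exists x].
Qed.

Lemma continuous_integrb mu f : continuous f -> integrb mu f.
Proof.
move=> cf; have [M fM] := continuous_bounded cf.
by apply: bounded_integrb fM; exact: continuous_borel.
Qed.

End integ_theory.

(** * Layer-cake sums and agreement of the functional with the integral *)

Lemma sum_clamp {R : realType} (t : R) n : 0 <= t ->
  \sum_(k < n) Num.min 1 (Num.max 0 (t - k%:R)) = Num.min n%:R t.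
Proof.
(* The [k]-th term is the length of the part of [[0, t]] inside [[k, k + 1]]. *)
move=> t0; elim: n => [|n IH]; first by rewrite big_ord0 min_l.
rewrite big_ord_recr/= IH -natr1; have [tn|nt] := leP t n%:R.
  rewrite max_l ?subr_le0// (min_r ler01) addr0 min_r//.
  by rewrite (le_trans tn)// lerDl.
rewrite max_r ?subr_ge0 ?(ltW nt)//.
have [tn1|nt1] := leP 1 (t - n%:R).
  by rewrite min_l// -lerBrDl.
by rewrite min_r ?subrKC// ltW// -ltrBlDl.
Qed.

Lemma sum_ltr_nat_le {R : realType} (t : R) n : 0 <= t ->
  \sum_(k < n) (k%:R < t)%R%:R <= t + 1 :> R.
Proof.
(* The induction also carries the bound by [n]: if [n < t], the new term raises the sum to at most
   [n + 1 <= t + 1]. *)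
move=> t0; suff : \sum_(k < n) (k%:R < t)%R%:R <= Num.min n%:R (t + 1).
  by move=> /le_trans; apply; rewrite ge_min lexx orbT.
elim: n => [|n]; first by rewrite big_ord0 le_min lexx addr_ge0.
rewrite big_ord_recr/= !le_min -natr1 => /andP[? ?]; apply/andP.
by case: (ltP n%:R t) => ? /=; split; lra.
Qed.

Section representation.
Context {R : realType} {X : pseudoPMetricType R}.
Hypothesis cX : compact [set: X].
Variable L : (X -> R) -> R.
Hypothesis LD : forall f g : X -> R, continuous f -> continuous g ->
  L (fun x => f x + g x) = L f + L g.
Hypothesis LZ : forall (c : R) (f : X -> R), continuous f ->
  L (fun x => c * f x) = c * L f.
Hypothesis L_ge0 : forall f : X -> R,
  continuous f -> (forall x, 0 <= f x) -> 0 <= L f.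
Hypothesis L1 : L (fun=> 1) = 1.
Variable mu : @probX R X.
Hypothesis muE : forall G, open G -> mu G = (open_size L G)%:E.
Implicit Types (f : X -> R) (G : set X).

(* Layer-cake decomposition of [n f] into the [n] functions
   [min 1 (max 0 (n f - k))], the [k]-th of which lies below [{n f > k}]. *)
Lemma functional_le_integ01 f n : continuous f -> (forall x, 0 <= f x <= 1) ->
  n.+1%:R * L f <= n.+1%:R * integ mu f + 1.
Proof.
move=> cf f01; set N := n.+1.
have Nf0 x : 0 <= N%:R * f x by case/andP: (f01 x) => ? _; rewrite mulr_ge0.
have cNf : continuous (fun x => N%:R * f x).
  by move=> x; apply: cvgM; [exact: cvg_cst|exact: cf].
pose h k x := Num.min 1 (Num.max 0 (N%:R * f x - k%:R)).
pose G k := [set x | k%:R < N%:R * f x].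
have oG k : open (G k).
  apply: (@open_comp _ _ (fun x => N%:R * f x) [set y | k%:R < y]) => [x _|].
    exact: cNf.
  exact: open_gt.
have hG k : below (G k) (h k).
  split => [x|x|x].
  - apply: (@continuous_min R X (fun=> 1)
      (fun x => Num.max 0 (N%:R * f x - k%:R))); first exact: cvg_cst.
    apply: (@continuous_max R X (fun=> 0) (fun x => N%:R * f x - k%:R)).
      exact: cvg_cst.
    by apply: cvgB; [exact: cNf|exact: cvg_cst].
  - by rewrite /h le_min ler01 le_max lexx.
  - rewrite indicE; case: (boolP (x \in G k)) => [_|/negP Gx].
      by rewrite /h ge_min lexx.
    rewrite /h ge_min ge_max /= lexx/= subr_le0; apply/orP; right.
    by rewrite leNgt; apply/negP => kNf; apply: Gx; rewrite inE.
have -> : N%:R * L f = \sum_(k < N) L (h k).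
  rewrite -LZ// -(functional_sum LD LZ L1) => [|k]; last by case: (hG k).
  congr L; apply/funext => x; rewrite sum_clamp//.
  by case/andP: (f01 x) => _ fx1; rewrite min_r// ler_piMr.
(* Each layer satisfies [L (h k) <= open_size L (G k) = mu (G k)]; the sum of the indicators of the
   [G k] is at most [N f + 1]. *)
apply: (@le_trans _ _ (\sum_(k < N) integ mu (\1_(G k)))).
  apply: ler_sum => k _; rewrite -lee_fin integ_indic// muE// lee_fin.
  exact: (open_size_ub LD LZ L_ge0 L1 (hG k)).
have iG k : integrb mu \1_(G k) by exact: integrb_indic.
have if_ := @continuous_integrb R X cX mu _ cNf.
rewrite -(integ_sum N iG) -integZ; last exact: continuous_integrb.
rewrite -[X in _ + X](integ_cst mu) -integD//; last first.
  by apply: continuous_integrb => // x; exact: cvg_cst.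
apply: integ_le => [||x].
- exact: (integrb_sum N iG).
- apply: continuous_integrb => // x.
  by apply: cvgD; [exact: cNf|exact: cvg_cst].
- apply: le_trans (sum_ltr_nat_le N (Nf0 x)); apply: ler_sum => k _.
  rewrite indicE ler_nat; case: (boolP (x \in _)) => // /set_mem.
  by rewrite /G/= => ->.
Qed.

(** After division by [n.+1] the layer-cake error is [1 / n.+1], which is arbitrarily small. *)
Lemma functional_le_integ_01 f : continuous f -> (forall x, 0 <= f x <= 1) ->
  L f <= integ mu f.
Proof.
move=> cf f01; apply/ler_addgt0Pr => e e0.
have [n ne] : exists n : nat, e^-1 < n.+1%:R.
  exists (Num.bound e^-1); rewrite (lt_trans (archi_boundP _)) ?ltr_nat//.
  by rewrite invr_ge0 ltW.
have n0 : 0 < n.+1%:R :> R by [].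
rewrite -(ler_pM2l n0) (le_trans (functional_le_integ01 n cf f01))//.
by rewrite mulrDr lerD2l -[leLHS](mulVf (lt0r_neq0 e0)) ler_pM2r// ltW.
Qed.

(** The reverse inequality is the same bound applied to [1 - f]. *)
Lemma functional_integ_01 f : continuous f -> (forall x, 0 <= f x <= 1) ->
  integ mu f = L f.
Proof.
move=> cf f01; apply/eqP; rewrite eq_le functional_le_integ_01// andbT.
have cNf : continuous (fun x => - 1 * f x).
  by move=> x; apply: cvgM; [exact: cvg_cst|exact: cf].
have c1 : continuous ((fun=> 1) : X -> R) by move=> x; exact: cvg_cst.
have := @functional_le_integ_01 (fun x => 1 + - 1 * f x).
rewrite LD// LZ// L1 integD; [|exact: continuous_integrb..].
rewrite integZ; last exact: continuous_integrb.
rewrite integ_cst lerD2l !mulN1r lerN2; apply.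
  by move=> x; apply: cvgD; [exact: c1|exact: cNf].
by move=> x; case/andP: (f01 x) => ? ?; apply/andP; split; lra.
Qed.

Lemma functional_integ f : continuous f -> integ mu f = L f.
Proof.
move=> cf; have [M0 fM0] := continuous_bounded cX cf.
have [M M_gt0 fM] : exists2 M, 0 < M & forall x, `|f x| <= M.
  exists (`|M0| + 1) => [|x]; first by rewrite ltr_pwDr.
  by rewrite (le_trans (fM0 x))// (le_trans (ler_norm _))// lerDl.
(* This affine change carries the range [[-M, M]] into [[0, 1]]; it is invertible because
   [M > 0]. *)
pose g x := 2^-1 + (2 * M)^-1 * f x.
have Mn0 : M != 0 by rewrite gt_eqF.
have M2 : 0 < 2 * M by rewrite mulr_gt0.
have ccf c : continuous (fun x => c * f x).
  by move=> x; apply: cvgM; [exact: cvg_cst|exact: cf].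
have cc (c : R) : continuous ((fun=> c) : X -> R) by move=> x; exact: cvg_cst.
have : integ mu g = L g.
  apply: functional_integ_01 => [x|x].
    by apply: cvgD; [exact: cc|exact: ccf].
  have := fM x; rewrite ler_norml => /andP[fx1 fx2]; rewrite /g.
  have e1 : (2 * M)^-1 * M = 2^-1 by rewrite invfM mulfVK.
  have i0 : 0 <= (2 * M)^-1 by rewrite invr_ge0 ltW.
  have := ler_wpM2l i0 fx1; have := ler_wpM2l i0 fx2; rewrite mulrN e1 => ? ?.
  by apply/andP; split; lra.
rewrite /g LD// LZ// integD; [|exact: continuous_integrb..].
rewrite integZ; last exact: continuous_integrb.
rewrite integ_cst (functional_cst LZ L1) => /addrI; apply: mulfI.
by rewrite invr_neq0// gt_eqF.
Qed.

End representation.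

(** * Representation of invariant functionals by invariant measures *)

Section invariant_representation.
Context {R : realType} {X : pseudoPMetricType R}.
Hypothesis cX : compact [set: X].
Variable T : X -> X.
Hypothesis cT : continuous T.
Local Notation borelX := (g_sigma_algebraType (@open X)).

(** The push-forward of [mu] and [mu] are finite measures agreeing on the open sets, which are
    stable under intersection and generate the Borel sets. *)
Lemma invariant_open (mu : @probX R X) :
  (forall G, open G -> mu (T @^-1` G) = mu G) -> MT T mu.
Proof.
move=> muT A mA; have mT := continuous_borel_self cT.
pose nu : {measure set borelX -> \bar R} :=
  measure_function_pushforward__canonical__measure_function_Measure mu mT.
apply: (@measure_unique _ R borelX (@open X) (fun=> setT) _ _ _ _ nu mu) => //.
- exact: openI.
- by move=> _; exact: openT.
- by apply/seteqP; split => // x _; exists 0%N.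
- move=> _; rewrite [X in (X < _)%E](_ : _ = mu [set: borelX])//.
  by rewrite [X in (X < _)%E]probability_setT ltry.
Qed.

Lemma invariant_functional_integ (L : (X -> R) -> R) :
  (forall f g : X -> R, continuous f -> continuous g ->
    L (fun x => f x + g x) = L f + L g) ->
  (forall (c : R) (f : X -> R), continuous f ->
    L (fun x => c * f x) = c * L f) ->
  (forall f : X -> R, continuous f -> (forall x, 0 <= f x) -> 0 <= L f) ->
  L (fun=> 1) = 1 ->
  (forall f : X -> R, continuous f -> L (f \o T) = L f) ->
  exists2 mu : probX, MT T mu &
    forall f : X -> R, continuous f -> integ mu f = L f.
Proof.
move=> LD LZ L_ge0 L1 LT.
have [mu muE] := functional_measure cX LD LZ L_ge0 L1.
exists mu; last by move=> f; exact: functional_integ muE f.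
apply: invariant_open => G oG; rewrite !muE//; last first.
  by apply: (@open_comp _ _ T) => // x _; exact: cT.
by congr EFin; apply: open_size_preimage.
Qed.

End invariant_representation.

(** * Averages of asymptotically additive potentials *)

Section invariant_averages.
Context {R : realType} {X : pseudoPMetricType R}.
Hypothesis cX : compact [set: X].
Variable T : X -> X.
Hypothesis cT : continuous T.
Local Notation borelX := (g_sigma_algebraType (@open X)).
Implicit Types (mu : @probX R X) (f g : X -> R) (F : nat -> X -> R).

Lemma invariant_integ mu f : MT T mu -> continuous f ->
  integ mu (f \o T) = integ mu f.
Proof.
move=> muT cf; have mT := continuous_borel_self cT.
have cfT : continuous (f \o T).
  by move=> x; apply: continuous_comp; [exact: cT|exact: cf].
pose nu : {measure set borelX -> \bar R} :=
  measure_function_pushforward__canonical__measure_function_Measure mu mT.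
rewrite /integ; congr fine.
rewrite [RHS](@eq_measure_integral _ _ _ [set: borelX] nu mu) => [|A mA _]; last first.
  exact/esym/muT.
rewrite [RHS](@integral_pushforward _ _ borelX borelX R T mT mu setT (EFin \o f))//.
- by apply/measurable_EFinP; exact: continuous_borel.
- exact: (continuous_integrb cX mu cfT).
Qed.

Lemma continuous_iter i : continuous (iter i T).
Proof.
elim: i => [|i IH] x; first exact: cvg_id.
by apply: (@continuous_comp _ _ _ (iter i T) T); [exact: IH|exact: cT].
Qed.

Lemma continuous_birkhoff n f : continuous f -> continuous (birkhoff T n f).
Proof.
move=> cf; apply: continuous_sumr => i x.
by apply: (@continuous_comp _ _ _ (iter i T) f); [exact: continuous_iter|exact: cf].
Qed.

Lemma invariant_integ_birkhoff mu n f : MT T mu -> continuous f ->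
  integ mu (birkhoff T n f) = n%:R * integ mu f.
Proof.
move=> muT cf.
have cfT i : continuous (f \o iter i T).
  move=> x; apply: continuous_comp; [exact: continuous_iter|exact: cf].
have icfT i := continuous_integrb cX mu (cfT i).
rewrite /birkhoff (integ_sum n icfT) (eq_bigr (fun=> integ mu f)) => [|i _].
  by rewrite sumr_const card_ord mulr_natl.
elim: (nat_of_ord i) => // {}i IH; rewrite -[RHS]IH -[RHS]invariant_integ//.
by congr integ; apply/funext => x; rewrite /= -iterSr.
Qed.

Lemma le_supnorm f x : continuous f -> `|f x| <= supnorm f.
Proof.
move=> cf; apply: ub_le_sup; last by exists x.
have [M fM] := continuous_bounded cX cf.
by exists M => _ [y _ <-].
Qed.

Lemma integ_dist mu f g e : continuous f -> continuous g ->
  (forall x, `|f x - g x| <= e) -> `|integ mu f - integ mu g| <= e.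
Proof.
move=> cf cg fg; have cc (c : R) : continuous ((fun=> c) : X -> R).
  by move=> x; exact: cvg_cst.
rewrite ler_distl lerBlDr; apply/andP; split.
- rewrite -[X in _ + X](integ_cst mu) -integD; [|exact: continuous_integrb..].
  apply: integ_le => [||x]; [exact: continuous_integrb| |].
    by apply: continuous_integrb => // x; apply: cvgD; [exact: cf|exact: cc].
  by have := fg x; rewrite ler_distl lerBlDr => /andP[].
- rewrite -[X in _ + X](integ_cst mu) -integD; [|exact: continuous_integrb..].
  apply: integ_le => [||x]; [exact: continuous_integrb| |].
    by apply: continuous_integrb => // x; apply: cvgD; [exact: cg|exact: cc].
  by have := fg x; rewrite ler_distl lerBlDr => /andP[].
Qed.

(** The upper limit is an infimum over neighbourhoods [V] of infinity of suprema over [V], so one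
    such supremum is already below [c]. *)
Lemma limn_esup_lt_near (u : nat -> \bar R) c :
  (limn_esup u < c)%E -> \forall n \near \oo, (u n < c)%E.
Proof.
move=> /ereal_inf_lt[_ [V nV <-] Vc]; apply: filterS nV => n Vn.
by apply: le_lt_trans Vc; apply: ereal_sup_ubound; exists n.
Qed.

(** Invariance turns the normalised integral of the Birkhoff sum of [g] into [integ mu g]; the
    sup-norm bound makes the threshold on [n] uniform in [mu]. *)
Lemma AAP_near F e : AAP T F -> 0 < e -> exists2 g, continuous g &
  \forall n \near \oo, forall mu, MT T mu ->
    `|n%:R^-1 * integ mu (F n) - integ mu g| <= e.
Proof.
move=> [cF apF] e0; have [g [cg /limn_esup_lt_near gF]] := apF e e0.
exists g => //; near=> n => mu muT.
have n0 : 0 < n%:R :> R by rewrite ltr0n; near: n; exact: nbhs_infty_gt.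
rewrite -(ler_pM2l n0) -[X in X * `|_|](gtr0_norm n0) -normrM mulrBr.
rewrite mulVKf ?gt_eqF// -invariant_integ_birkhoff//.
have cb := @continuous_birkhoff n g cg.
apply: integ_dist => // x.
have cFb : continuous (F n \- birkhoff T n g).
  by move=> y; apply: cvgB; [exact: cF|exact: cb].
apply: le_trans (@le_supnorm _ x cFb) _.
rewrite -ler_pdivrMl// ltW// -lte_fin.
by near: n.
Unshelve. all: by end_near. Qed.

(** The averages are Cauchy: for each [e] they eventually stay within [e / 2] of the fixed number
    [integ mu g]. *)
Lemma is_cvg_Fstar F mu : AAP T F -> MT T mu ->
  cvgn (fun n => n%:R^-1 * integ mu (F n)).
Proof.
move=> aF muT; apply/cauchy_cvgP/cauchy_exP => e e0.
have e20 : 0 < e / 2 by rewrite divr_gt0.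
have [g cg gF] := AAP_near aF e20; exists (integ mu g).
apply: filterS gF => n /(_ mu muT) h.
rewrite -ball_normE/= distrC; apply: le_lt_trans h _.
by rewrite ltr_pdivrMr// ltr_pMr// ltr1n.
Qed.

(** Passing to the limit keeps the uniformity in [mu]; boundedness, affinity and continuity of
    [Fstar F] follow from this approximation. *)
Lemma Fstar_approx F e : AAP T F -> 0 < e -> exists2 g, continuous g &
  forall mu, MT T mu -> `|Fstar F mu - integ mu g| <= e.
Proof.
move=> aF e0; have [g cg gF] := AAP_near aF e0; exists g => // mu muT.
have cF := is_cvg_Fstar aF muT.
rewrite ler_distl; apply/andP; split.
- apply: limr_ge => //; apply: filterS gF => n /(_ mu muT).
  by rewrite ler_distl => /andP[].
- apply: limr_le => //; apply: filterS gF => n /(_ mu muT).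
  by rewrite ler_distl => /andP[].
Qed.

Lemma Fstar_bounded F : AAP T F ->
  exists M, forall mu, MT T mu -> `|Fstar F mu| <= M.
Proof.
move=> aF; have [g cg gF] := Fstar_approx aF ltr01.
have [M gM] := continuous_bounded cX cg; exists (1 + M) => mu muT.
rewrite -(subrK (integ mu g) (Fstar F mu)) (le_trans (ler_normD _ _))//.
apply: lerD; first exact: gF.
have c0 : continuous ((fun=> 0) : X -> R) by move=> x; exact: cvg_cst.
rewrite -[integ mu g]subr0 -(integ_cst mu 0); apply: integ_dist => // x.
by rewrite subr0.
Qed.

Lemma Fstar_affine F (k mu nu : probX) t : AAP T F ->
  MT T k -> MT T mu -> MT T nu -> 0 <= t <= 1 ->
  (forall f, continuous f ->
    integ k f = (1 - t) * integ mu f + t * integ nu f) ->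
  Fstar F k = (1 - t) * Fstar F mu + t * Fstar F nu.
Proof.
move=> aF kT muT nuT /andP[t0 t1] kE; apply/eqP; rewrite -subr_eq0 -normr_le0.
apply/ler_addgt0Pr => e e0; rewrite add0r.
(* One half of [e] is spent on [k], the other on the convex combination of [mu] and [nu]. *)
have e20 : 0 < e / 2 by rewrite divr_gt0.
have [g cg gF] := Fstar_approx aF e20.
have := gF _ kT; have := gF _ muT; have := gF _ nuT; rewrite (kE g cg).
rewrite !ler_distl => /andP[a1 a2] /andP[b1 b2] /andP[c1 c2].
have t1' : 0 <= 1 - t by rewrite subr_ge0.
have := ler_wpM2l t0 a1; have := ler_wpM2l t0 a2.
have := ler_wpM2l t1' b1; have := ler_wpM2l t1' b2.
by move=> *; apply/andP; split; lra.
Qed.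

(** The usual three-term estimate for a uniform limit of continuous functionals, each term costing
    [e / 3]. *)
Lemma cvg_Fstar F (U : set_system nat) (m : nat -> probX) mu : Filter U ->
  AAP T F -> (forall n, MT T (m n)) -> MT T mu ->
  (forall f, continuous f -> integ (m n) f @[n --> U] --> integ mu f) ->
  Fstar F (m n) @[n --> U] --> Fstar F mu.
Proof.
move=> FU aF mT muT mmu; apply/cvgrPdist_le => e e0.
have e30 : 0 < e / 3 by rewrite divr_gt0.
have [g cg gF] := Fstar_approx aF e30.
have /cvgrPdist_le /(_ _ e30) := mmu g cg; apply: filterS => n.
have := gF _ (mT n); have := gF _ muT.
rewrite !ler_norml => /andP[? ?] /andP[? ?] /andP[? ?].
by apply/andP; split; lra.
Qed.

End invariant_averages.

(** * Compactness and convexity of the set of invariant measures *)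

Section weak_compactness.
Context {R : realType} {X : pseudoPMetricType R}.
Hypothesis cX : compact [set: X].
Variable T : X -> X.
Hypothesis cT : continuous T.
Implicit Types (mu : @probX R X) (f g : X -> R) (F : nat -> X -> R).

(** A cluster point exists in the compact segment [[-M, M]], and an ultrafilter converges to each of
    its cluster points. *)
Lemma ultra_bounded_cvg (I : Type) (U : set_system I) (u : I -> R) M :
  UltraFilter U -> (forall i, `|u i| <= M) -> cvg (u i @[i --> U]).
Proof.
move=> UU uM; have [|x [_ clx]] := @segment_compact R (- M) M (u @ U) _.
  by apply: nearW => i /=; rewrite in_itv/= -ler_norml uM.
apply/cvg_ex; exists x => V xV.
have [//|UV] := in_ultra_setVsetC (u @^-1` V) UU.
by have [y []] := clx (~` V) V UV xV.
Qed.

(** A filter [U] finer than [\oo] takes the place of a subsequence: a single ultrafilter makes the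
    integrals of all continuous functions converge at once. *)
Lemma MT_compact (m : nat -> probX) : (forall n, MT T (m n)) ->
  exists (U : set_system nat) (mu : probX),
    [/\ ProperFilter U, \oo `<=` U, MT T mu & forall f, continuous f ->
      integ (m n) f @[n --> U] --> integ mu f].
Proof.
move=> mT; have [U [UU ooU]] := @ultraFilterLemma _ \oo _.
pose L f := lim (integ (m n) f @[n --> U]).
have cL f : continuous f -> integ (m n) f @[n --> U] --> L f.
  move=> cf; have [M fM] := continuous_bounded cX cf.
  apply: (@ultra_bounded_cvg _ U _ M) => n.
  rewrite -[integ _ _]subr0 -[X in _ - X](integ_cst (m n)).
  apply: integ_dist => // x; first exact: cvg_cst.
  by rewrite subr0.
have [||||f cf|mu muT muE] := @invariant_functional_integ R X cX T cT L.
- move=> f g cf cg; apply: cvg_lim => //.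
  rewrite (_ : (fun n => _) = fun n => integ (m n) f + integ (m n) g).
    by apply: cvgD; exact: cL.
  by apply/funext => n; rewrite integD//; exact: continuous_integrb.
- move=> c f cf; apply: cvg_lim => //.
  rewrite (_ : (fun n => _) = fun n => c * integ (m n) f).
    by apply: cvgM; [exact: cvg_cst|exact: cL].
  by apply/funext => n; rewrite integZ//; exact: continuous_integrb.
- move=> f cf f0; apply: (cvgr_to_ge (cL f cf)); apply: nearW => n.
  exact: integ_ge0.
- apply: cvg_lim => //; under eq_fun do rewrite integ_cst.
  exact: cvg_cst.
- by congr lim; under eq_fun do rewrite invariant_integ//.
exists U, mu; split => //; first exact: ultra_proper.
by move=> f cf; rewrite muE//; exact: cL.
Qed.

Lemma MT_convex mu nu t : MT T mu -> MT T nu -> 0 <= t <= 1 ->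
  exists2 k, MT T k & forall f, continuous f ->
    integ k f = (1 - t) * integ mu f + t * integ nu f.
Proof.
move=> muT nuT /andP[t0 t1]; have t1' : 0 <= 1 - t by rewrite subr_ge0.
apply: (@invariant_functional_integ R X cX T cT
  (fun f => (1 - t) * integ mu f + t * integ nu f)).
- move=> f g cf cg; rewrite !integD; [|exact: continuous_integrb..].
  by rewrite !mulrDr addrACA.
- move=> c f cf; rewrite !integZ; [|exact: continuous_integrb..].
  by rewrite mulrDr !(mulrCA c).
- by move=> f cf f0; rewrite addr_ge0// mulr_ge0// integ_ge0.
- by rewrite !integ_cst !mulr1 subrK.
- by move=> f cf; rewrite !invariant_integ.
Qed.

End weak_compactness.

(** * Upper boundary of a compact convex planar set *)

(* For a pair of affine functions [phi], [psi] on a convex sequentially compact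
   set, [value] is the upper boundary of the planar convex set [(phi, psi)(S)]. *)
Section conditional_maximum.
Context {R : realType} {M : Type}.
Variables (S : set M) (phi psi : M -> R).
Hypothesis convexS : forall mu nu t, S mu -> S nu -> 0 <= t <= 1 ->
  exists k, [/\ S k, phi k = (1 - t) * phi mu + t * phi nu &
                     psi k = (1 - t) * psi mu + t * psi nu].
Hypothesis compactS : forall m : nat -> M, (forall n, S (m n)) ->
  exists (U : set_system nat) (mu : M),
    [/\ ProperFilter U, \oo `<=` U, S mu,
        phi (m n) @[n --> U] --> phi mu & psi (m n) @[n --> U] --> psi mu].
Variable B : R.
Hypothesis psiB : forall mu, S mu -> `|psi mu| <= B.
Hypothesis phiB : forall mu, S mu -> `|phi mu| <= B.

Let level a := [set mu | S mu /\ phi mu = a].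
Let value a := sup [set psi mu | mu in level a].

Lemma value_ub mu : S mu -> psi mu <= value (phi mu).
Proof.
move=> Smu; apply: ub_le_sup; last by exists mu.
exists B => _ [nu [Snu _] <-].
by rewrite (le_trans (ler_norm _))// psiB.
Qed.

(** Otherwise points over values tending to [a] keep [psi] at least [value a + e], and so does their
    limit, which lies over [a]. The bound concerns members of [level b], since [value b] is a
    default when that level is empty. *)
Lemma value_usc (a e : R) : 0 < e ->
  \forall b \near a, forall mu, level b mu -> psi mu < value a + e.
Proof.
move=> e0; apply: contrapT => nope.
have bad (n : nat) : exists mu, [/\ S mu, `|a - phi mu| < n.+1%:R^-1 &
    value a + e <= psi mu].
  apply: contrapT => none; apply: nope.
  have n0 : 0 < n.+1%:R^-1 :> R by rewrite invr_gt0.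
  have /cvgrPdist_lt /(_ _ n0) ab : b @[b --> a] --> a by exact: cvg_id.
  near=> b => mu [Smu mub]; rewrite ltNge; apply/negP => h.
  apply: none; exists mu; split => //; rewrite mub.
  by near: b.
have [m mP] := choice bad.
have Sm n : S (m n) by case: (mP n).
have [U [mu [PU ooU Smu phimu psimu]]] := compactS Sm.
have phia : phi mu = a.
  apply: (@cvg_unique _ (@Rhausdorff R) (phi (m n) @[n --> U])) => //.
  apply/cvgrPdist_lt => d d0; apply: ooU.
  near=> n; have [_ h _] := mP n; apply: lt_trans h _.
  by near: n; exact: near_infty_natSinv_lt (PosNum d0).
have : value a + e <= psi mu.
  by apply: (cvgr_to_ge psimu); apply: nearW => n; case: (mP n).
have := value_ub Smu; rewrite phia => h1 h2.
by move: (le_trans h2 h1); rewrite gerDl leNgt e0.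
Unshelve. all: by end_near. Qed.

Lemma level_between mu nu b : S mu -> S nu -> phi mu <= b <= phi nu ->
  exists k, level b k.
Proof.
move=> Smu Snu /andP[mub bnu]; have [e|d] := eqVneq (phi mu) (phi nu).
  by exists mu; split => //; apply/eqP; rewrite eq_le mub e bnu.
have mn : phi mu < phi nu by rewrite lt_neqAle d (le_trans mub).
have mn0 : 0 < phi nu - phi mu by rewrite subr_gt0.
have [|k [Sk kE _]] := @convexS mu nu ((b - phi mu) / (phi nu - phi mu)) Smu Snu.
  by rewrite divr_ge0 ?subr_ge0 ?(ltW mn)//= ler_pdivrMr// mul1r lerD2r.
exists k; split => //; rewrite kE; field; exact: lt0r_neq0.
Qed.

(* The chord from a near-maximiser [mu] over [a] to any [nu] bounds the
   value function from below. *)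
Lemma value_lsc_chord mu nu (e : R) : S mu -> S nu -> phi nu != phi mu -> 0 < e ->
  \forall b \near phi mu, 0 <= (b - phi mu) / (phi nu - phi mu) ->
    psi mu - e < value b.
Proof.
move=> Smu Snu nm e0; have B0 : 0 <= B by exact: le_trans (psiB Smu).
pose c := phi nu - phi mu.
have c0 : c != 0 by rewrite subr_eq0.
have nc0 : 0 < `|c| by rewrite normr_gt0.
(* With [t < d] the weight is below 1 and the loss [t * (psi mu - psi nu) <= 2 * B * t] is below
   [e]; the [+ 1] keeps the denominator positive when [B = 0]. *)
pose d := Num.min 1 (e / (2 * B + 1)).
have d0 : 0 < d by rewrite lt_min ltr01 divr_gt0// ltr_wpDl// mulr_ge0.
have cd0 : 0 < d * `|c| by rewrite mulr_gt0.
have /cvgrPdist_lt /(_ _ cd0) ab : b @[b --> phi mu] --> phi mu by exact: cvg_id.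
near=> b => t0; set t := (b - phi mu) / c in t0.
have td : t < d.
  have bd : `|phi mu - b| < d * `|c| by near: b.
  by rewrite -(ger0_norm t0) normrM normfV ltr_pdivrMr// distrC.
move: td; rewrite lt_min => /andP[t1 te].
have [|k [Sk kphi kpsi]] := @convexS mu nu t Smu Snu.
  by rewrite t0 ltW.
have kb : phi k = b by rewrite kphi /t /c; field.
apply: lt_le_trans (_ : psi k <= _); last by rewrite -kb; exact: value_ub.
have := psiB Smu; have := psiB Snu; rewrite !ler_norml => /andP[n1 _] /andP[_ n2].
move: te; rewrite ltr_pdivlMr; last by rewrite ltr_wpDl// mulr_ge0.
have := ler_wpM2l t0 n1; have := ler_wpM2l t0 n2; rewrite kpsi.
by move=> *; lra.
Unshelve. all: by end_near. Qed.

(** A limit of a maximising sequence is a maximiser; minimisers come from the same lemma applied to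
    [- phi]. *)
Lemma phi_extrema : S !=set0 ->
  exists2 mu, S mu & forall nu, S nu -> phi nu <= phi mu.
Proof.
move=> [s0 Ss0]; have hs : has_sup [set phi mu | mu in S].
  split; first by exists (phi s0), s0.
  exists B => _ [nu Snu <-].
  by rewrite (le_trans (ler_norm _))// phiB.
have near_sup (n : nat) : exists mu, S mu /\
    sup [set phi mu | mu in S] - n.+1%:R^-1 < phi mu.
  have n0 : 0 < n.+1%:R^-1 :> R by rewrite invr_gt0.
  by have [_ [mu Smu <-] h] := sup_adherent n0 hs; exists mu.
have [m mP] := choice near_sup.
have Sm n : S (m n) by case: (mP n).
have [U [mu [PU ooU Smu phimu _]]] := compactS Sm.
exists mu => // nu Snu.
apply: (@le_trans _ _ (sup [set phi mu | mu in S])).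
  by apply: ub_le_sup; [case: hs|exists nu].
apply/ler_addgt0Pr => e e0; rewrite -lerBlDr.
apply: (cvgr_to_ge phimu); apply: ooU.
near=> n; have [_ /ltW] := mP n; apply: le_trans; rewrite lerD2l lerN2 ltW//.
by near: n; exact: near_infty_natSinv_lt (PosNum e0).
Unshelve. all: by end_near. Qed.

(** The chord starts at an [e / 2]-maximiser over [a]. Requiring [b] between [a] and [phi nu] makes
    its weight nonnegative; a [nu] of maximal or minimal [phi] then serves one side of [a]. *)
Lemma value_lsc nu (a e : R) : S nu -> level a !=set0 -> 0 < e ->
  \forall b \near a, (a <= b <= phi nu) || (phi nu <= b <= a) ->
    value a - e < value b.
Proof.
move=> Snu [m0 am0] e0.
have [na|na] := eqVneq (phi nu) a.
  near=> b; rewrite na -!eq_le => bab.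
  have -> : b = a by apply/eqP; case/orP: bab; rewrite eq_sym.
  by rewrite ltrBlDr ltrDl.
have hs : has_sup [set psi mu | mu in level a].
  split; first by exists (psi m0), m0.
  by exists B => _ [mu [Smu _] <-]; rewrite (le_trans (ler_norm _))// psiB.
have e20 : 0 < e / 2 by rewrite divr_gt0.
have [_ [mu [Smu mua] <-] muE] := sup_adherent e20 hs.
have nmu : phi nu != phi mu by rewrite mua.
have := value_lsc_chord Smu Snu nmu e20; rewrite mua; apply: filterS => b h bab.
have {}h : psi mu - e / 2 < value b.
  apply: h; case/orP: bab => /andP[ab bn].
    by rewrite divr_ge0// subr_ge0// (le_trans ab).
  by rewrite -mulrNN -invrN mulr_ge0 ?invr_ge0// ?oppr_ge0 subr_le0// (le_trans ab).
by move: muE; rewrite -/(value a) => muE; lra.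
Unshelve. all: by end_near. Qed.

End conditional_maximum.

(** Upper semicontinuity comes from compactness; lower semicontinuity comes separately on the two
    sides of [a], from chords to a maximiser and to a minimiser of [phi]. *)
Lemma continuous_conditional_maximum {R : realType} {M : Type} (S : set M)
    (phi psi : M -> R) (B : R) :
  (forall mu nu t, S mu -> S nu -> 0 <= t <= 1 ->
    exists k, [/\ S k, phi k = (1 - t) * phi mu + t * phi nu &
                       psi k = (1 - t) * psi mu + t * psi nu]) ->
  (forall m : nat -> M, (forall n, S (m n)) ->
    exists (U : set_system nat) (mu : M),
      [/\ ProperFilter U, \oo `<=` U, S mu,
          phi (m n) @[n --> U] --> phi mu & psi (m n) @[n --> U] --> psi mu]) ->
  (forall mu, S mu -> `|psi mu| <= B) ->
  (forall mu, S mu -> `|phi mu| <= B) ->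
  {within `[inf [set phi mu | mu in S], sup [set phi mu | mu in S]],
    continuous (fun a => sup [set psi mu | mu in [set mu | S mu /\ phi mu = a]])}.
Proof.
move=> convexS compactS psiB phiB.
(* With [S] empty every level is empty and the function is constant. *)
have [->|] := eqVneq S set0.
  apply: continuous_subspaceT => a.
  rewrite (_ : (fun _ => _) = fun=> sup set0); first exact: cvg_cst.
  by apply/funext => b; congr sup; apply/seteqP; split => // x [mu [[]]].
move=> /set0P S0.
have [mx Smx mxP] := phi_extrema compactS phiB S0.
have [mn Smn mnP] : exists2 mn, S mn & forall nu, S nu -> phi mn <= phi nu.
  have [||mn Smn mnP] := @phi_extrema R M S (fun mu => - phi mu) psi _ B _ S0.
  - move=> m /compactS[U [mu [PU ooU Smu phimu psimu]]].
    by exists U, mu; split => //; exact: cvgN.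
  - by move=> mu Smu; rewrite normrN phiB.
  - by exists mn => // nu Snu; rewrite -lerN2; exact: mnP.
have -> : sup [set phi mu | mu in S] = phi mx.
  apply/eqP; rewrite eq_le; apply/andP; split.
    by apply: ge_sup; [exists (phi mx), mx|move=> _ [nu Snu <-]; exact: mxP].
  apply: ub_le_sup; last by exists mx.
  by exists (phi mx) => _ [nu Snu <-]; exact: mxP.
have -> : inf [set phi mu | mu in S] = phi mn.
  apply/eqP; rewrite eq_le; apply/andP; split; last first.
    by apply: lb_le_inf; [exists (phi mn), mn|move=> _ [nu Snu <-]; exact: mnP].
  apply: ge_inf; last by exists mn.
  by exists (phi mn) => _ [nu Snu <-]; exact: mnP.
have lev b : phi mn <= b <= phi mx -> [set mu | S mu /\ phi mu = b] !=set0.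
  exact: level_between convexS _ _ _ Smn Smx.
apply/subspace_continuousP => a /=; rewrite in_itv/= => aI.
apply/cvgrPdist_lt => e e0; rewrite near_withinE.
have e20 : 0 < e / 2 by rewrite divr_gt0.
have usc := value_usc compactS psiB a e20.
have lsc_mx := value_lsc convexS psiB Smx (lev a aI) e0.
have lsc_mn := value_lsc convexS psiB Smn (lev a aI) e0.
near=> b => /=; rewrite in_itv/= => bI.
pose v c := sup [set psi mu | mu in [set mu | S mu /\ phi mu = c]].
(* Taking the supremum over the level weakens the strict bound, hence the margin [e / 2]. *)
have vba : v b <= v a + e / 2.
  have [m1 lm1] := lev b bI; apply: ge_sup; first by exists (psi m1), m1.
  move=> _ [mu lmu <-]; apply/ltW; move: mu lmu.
  by near: b; exact: usc.
have vab : v a - e < v b.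
  have [ab|ba] := leP a b.
    have : (a <= b <= phi mx) || (phi mx <= b <= a).
      by rewrite ab; case/andP: bI => _ ->.
    by near: b; exact: lsc_mx.
  have : (a <= b <= phi mn) || (phi mn <= b <= a).
    by rewrite (ltW ba); case/andP: bI => -> _; rewrite orbT.
  by near: b; exact: lsc_mn.
suff : `|v a - v b| < e by [].
rewrite distrC ltr_distl vab/= (le_lt_trans vba)// ltrD2l.
by rewrite ltr_pdivrMr// ltr_pMr// ltr1n.
Unshelve. all: by end_near. Qed.

(** * Continuity of the conditional maximum ergodic average *)

Theorem theoremA (R : realType) (X : pseudoPMetricType R)
  (hX : hausdorff_space X) (cX : compact [set: X])
  (T : X -> X) (cT : continuous T)
  (F Phi : nat -> X -> R) (hF : AAP T F) (hPhi : AAP T Phi) :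
  {within `[etaP T Phi, betaP T Phi], continuous (Lambda T F Phi)}.
Proof.
have [BF FB] := Fstar_bounded cX cT hF.
have [BP PB] := Fstar_bounded cX cT hPhi.
(* The abscissa is the average of [Phi] and the ordinate that of [F]; one constant must bound both,
   hence the maximum. *)
apply: (@continuous_conditional_maximum R _ (MT T) (Fstar Phi) (Fstar F)
  (Num.max BF BP)).
- move=> mu nu t muT nuT t01.
  have [k kT kE] := MT_convex cX cT muT nuT t01.
  by exists k; split => //; exact: Fstar_affine kE.
- move=> m mT; have [U [mu [PU ooU muT mmu]]] := MT_compact cX cT mT.
  by exists U, mu; split => //; exact: cvg_Fstar mmu.
- by move=> mu muT; rewrite le_max FB.
- by move=> mu muT; rewrite le_max PB ?orbT.
Qed.
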